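(* Let $R$ be a large ideal domain, let $r\in\mathbb{N}$, and let $F\subseteq xR[x]$ be finite. If $R=\bigcup_{i=1}^{r} C_i$ is a finite coloring of $R$, then there exist $i\in\{1,2,\ldots,r\}$ and infinitely many $y\in R$ such that the set \[ \left\{ x\in R : \{xy\}\cup\{x+f(y):f\in F\}\subseteq C_i \right\} \] is piecewise syndetic in $(R,+)$.
   Context: A large ideal domain (LID) is an infinite integral domain $R$ such that every nontrivial (i.e. nonzero) ideal of $R$ has finite index in $R$ (as an additive subgroup). $xR[x]$ denotes the set of polynomials over $R$ with zero constant term. $\mathbb{N}=\{1,2,3,\ldots\}$. For a set $X$, $\mathcal{P}_f(X)$ denotes the set of finite nonempty subsets of $X$. For a commutative semigroup $(S,+)$, $A\subseteq S$ and $t\in S$, put $-t+A=\{s\in S: t+s\in A\}$. A set $A\subseteq S$ is piecewise syndetic if there exists $G\in\mathcal{P}_f(S)$ such that for every $H\in\mathcal{P}_f(S)$ there exists $x\in S$ with $H+x\subseteq\bigcup_{t\in G}(-t+A)$. *)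

(* Defs.v *)
From HB Require Import structures.
From mathcomp Require Import all_boot all_order all_algebra.
From mathcomp Require Import boolp classical_sets functions cardinality.

Set Implicit Arguments.
Unset Strict Implicit.
Unset Printing Implicit Defensive.

Import GRing.Theory.

Local Open Scope classical_set_scope.
Local Open Scope ring_scope.

(* The library's [idealr_closed] only covers proper, decidable ideals. *)
Definition ideal (R : comNzRingType) (I : set R) : Prop :=
  [/\ I 0,
      forall a b, I a -> I b -> I (a + b)
    & forall a b, I b -> I (a * b)].

Definition coset (V : zmodType) (H : set V) (a : V) : set V :=
  [set a + h | h in H].

Definition finite_index (V : zmodType) (H : set V) : Prop :=
  finite_set (range (coset H)).

Definition large_ideal_domain (R : idomainType) : Prop :=
  infinite_set [set: R] /\
  forall I : set R, ideal I -> I <> [set 0] -> finite_index I.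

Definition Pf (X : Type) : set (set X) :=
  [set A | finite_set A /\ A !=set0].

(* [addSemigroupType] is the library's structure of commutative additive
   semigroups; there is no subtraction, hence the preimage form of -t + A. *)
Definition neg_translate (S : addSemigroupType) (t : S) (A : set S) : set S :=
  [set s | A (t + s)].

Definition piecewise_syndetic (S : addSemigroupType) (A : set S) : Prop :=
  exists G : set S, Pf G /\
    forall H : set S, Pf H ->
      exists x : S,
        [set h + x | h in H] `<=` \bigcup_(t in G) neg_translate t A.

Definition xRx (R : nzRingType) : set {poly R} := [set f | f`_0 = 0].

(* Main.v *)
(** This is Moreira's argument. If [B] is piecewise syndetic and [G] is a finite
set of polynomials without constant term, then polynomial van der Waerden gives
[y] such that the set [D] of [x] in [B] with [x + g(y)] in [B] for all [g] in [G]
is piecewise syndetic. As [yR] has finite index, [y * D] is again piecewise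
syndetic, hence so is its part in some colour class; call that part the next set.
In the resulting chain [B_0, B_1, ...] one has [B_n] inside [p * B_m], where [p]
is the product of the [y]'s used between [m] and [n - 1]. Putting the polynomials
[p * f(p * X)] in [G] at step [n], the first repetition of a colour, between [B_m]
and [y * D], yields the configuration with [y * p] in place of [y], after
dividing by [p]. Polynomial van der Waerden is proved by colour focusing and
induction on the numbers of leading coefficients in each degree. *)

Require Import Defs.
From HB Require Import structures.
From mathcomp Require Import all_boot all_order all_algebra.
From mathcomp Require Import boolp classical_sets functions cardinality.
From mathcomp Require Import ring.

Set Implicit Arguments.
Unset Strict Implicit.
Unset Printing Implicit Defensive.

Import GRing.Theory.

Local Open Scope classical_set_scope.
Local Open Scope ring_scope.

(** * Lexicographic induction on weight sequences *)

Lemma lexicographic_ind (T : Type) (w : T -> nat -> nat) (P : T -> Prop) :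
  (forall F, (forall G, (exists2 j, (w G j < w F j)%N &
     forall i, (j < i)%N -> (w G i <= w F i)%N) -> P G) -> P F) ->
  forall n F, (forall i, (n <= i)%N -> w F i = 0%N) -> P F.
Proof.
move=> step n F wF0.
(* It suffices to know [P] for the [G] that drop at some [j >= k]: induction on [k], with an inner
   induction on [w F k] for drops at [k] itself. From [n] on no drop is possible. *)
have stepk k : forall F, (forall G, (exists j, [/\ (k <= j)%N, (w G j < w F j)%N &
     forall i, (j < i)%N -> (w G i <= w F i)%N]) -> P G) -> P F.
  elim: k => [|k IHk] {wF0}F ltF.
    by apply: step => G [j ? ?]; apply: ltF; exists j.
  have [m] := ubnP (w F k); elim: m => // m IHm in F ltF *.
  rewrite ltnS => wFm; apply: IHk => G [j [kj wGj wG]].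
  case: (ltngtP k j) kj => // [kj _|jk _]; first by apply: ltF; exists j.
  subst j.
  apply: IHm; last exact: leq_trans wGj wFm.
  move=> G' [j [kj wG'j wG']]; apply: ltF; exists j; split=> //.
    exact: leq_trans wG'j (wG _ kj).
  by move=> i ji; apply: leq_trans (wG' _ ji) (wG _ (ltn_trans kj ji)).
by apply: (stepk n) => G [j [nj]]; rewrite wF0.
Qed.

(** * Polynomial van der Waerden over an infinite domain, in finitary form *)

Section PolynomialVanDerWaerden.
Variable R : idomainType.
Implicit Types (f g : {poly R}) (F G : seq {poly R}).

(** [A] and [Y] are fixed before the colouring, so they are finite data independent of it. Avoiding
    [Z] later yields infinitely many [y]. *)
Definition poly_vdw F : Prop :=
  forall (K : finType) (Z : seq R), exists A Y : seq R,
    (forall y, y \in Y -> y \notin Z) /\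
    forall c : R -> K, exists a y,
      [/\ a \in A, y \in Y & forall f, f \in F -> c (a + f.[y]) = c a].

(** The increment of [f] from [h], minus [f1]; it vanishes at [0] as soon as [f1] does. *)
Definition vdw_diff f1 f (h : R) : {poly R} :=
  f \Po ('X + h%:P) - f.[h]%:P - f1.

Definition vdw_derived f1 F (Y : seq R) : seq {poly R} :=
  [seq vdw_diff f1 f h | f <- F, h <- Y].

Lemma horner_vdw_diff f1 f h d :
  (vdw_diff f1 f h).[d] = f.[d + h] - f.[h] - f1.[d].
Proof. by rewrite !hornerE horner_comp !hornerE. Qed.

(* The shift of [a] by [- f1.[d]] moves the focus while the polynomials of
   [vdw_derived] keep the colours already attained, and [d] attains a new one.
   For [s = #|K|] the colour of the focus [a] is itself attained. *)
Lemma color_focusing F f1 (K : finType) (Z : seq R) (s : nat) :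
  (forall f, f \in F -> f.[0] = 0) ->
  (forall Y, poly_vdw (vdw_derived f1 F Y)) ->
  exists A Y : seq R,
    (forall y, y \in Y -> y \notin Z) /\
    forall c : R -> K,
      (exists a y,
        [/\ a \in A, y \in Y & forall f, f \in F -> c (a + f.[y]) = c a]) \/
      (exists a (ks : {set K}), [/\ a \in A, #|ks| = s &
        forall k, k \in ks ->
          exists2 y, y \in Y & forall f, f \in F -> c (a + f.[y]) = k]).
Proof.
move=> F0 vdwF; elim: s => [|s [A [Y [YZ focus]]]].
  exists [:: 0], [::]; split=> // c; right; exists 0, finset.set0.
  by split=> [||k]; rewrite ?cards0 ?inE.
(* [W] lists the possible foci and attained points; colouring [x] by the tuple of colours of [x + w]
   controls all of them at once. *)
pose W := A ++ [seq a + b | a <- A, b <- [seq f.[y] | f <- F, y <- Y]].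
(* The entry [0] serves the new difference [d], the entries of [Y] the differences [d + y]; avoiding
   all [z - y] keeps [d + y] out of [Z]. *)
have [A' [Y' [YZ' vdw']]] := vdwF (0 :: Y) {ffun 'I_(size W) -> K}
  (Z ++ [seq z - y | z <- Z, y <- Y]).
exists ([seq x + a | x <- A', a <- A] ++
        [seq b - f1.[d] | b <- [seq x + a | x <- A', a <- A], d <- Y']).
exists (Y ++ Y' ++ [seq d + y | d <- Y', y <- Y]); split.
  move=> y; rewrite !mem_cat => /or3P[/YZ//|/YZ'|/allpairsP[[d u] /= [dY uY ->]]].
    by rewrite mem_cat negb_or => /andP[].
  apply: contra (YZ' _ dY) => zZ; rewrite mem_cat; apply/orP; right.
  by apply/allpairsP; exists (d + u, u); split=> //=; rewrite addrK.
move=> c.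
have [x [d [xA dY cx]]] := vdw' (fun x => [ffun i : 'I__ => c (x + W`_i)]).
have {}cx f h w : f \in F -> h \in 0 :: Y -> w \in W ->
    c (x + (f.[d + h] - f.[h] - f1.[d]) + w) = c (x + w).
  move=> fF hY wW; have iW : (index w W < size W)%N by rewrite index_mem.
  have /cx : vdw_diff f1 f h \in vdw_derived f1 F (0 :: Y).
    by apply/allpairsP; exists (f, h).
  rewrite horner_vdw_diff => /ffunP/(_ (Ordinal iW)).
  by rewrite !ffunE /= nth_index.
have [[a [y [aA yY good]]]|[a [ks [aA ksz col]]]] := focus (fun u => c (x + u)).
  left; exists (x + a), y; split=> [||f fF]; last by rewrite -addrA good.
  - by rewrite mem_cat; apply/orP; left; apply/allpairsP; exists (x, a).
  - by rewrite mem_cat yY.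
have [ca|ca] := boolP (c (x + a) \in ks).
  have [y yY cy] := col _ ca; left; exists (x + a), y.
  split=> [||f fF]; last by rewrite -addrA cy.
  - by rewrite mem_cat; apply/orP; left; apply/allpairsP; exists (x, a).
  - by rewrite mem_cat yY.
right; exists (x + a - f1.[d]), (c (x + a) |: ks)%SET; split.
- rewrite mem_cat; apply/orP; right; apply/allpairsP; exists (x + a, d).
  by split=> //=; apply/allpairsP; exists (x, a).
- by rewrite cardsU1 ca ksz.
move=> k; rewrite !inE => /orP[/eqP->|/col[y yY cy]].
  exists d; first by rewrite !mem_cat dY orbT.
  move=> f fF; rewrite -(cx f 0 a) ?mem_head// ?mem_cat ?aA//.
  by congr (c _); rewrite F0// addr0; ring.
exists (d + y).
  by rewrite !mem_cat; apply/or3P/Or33/allpairsP; exists (d, y).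
move=> f fF; rewrite -(cy f fF) -(cx f y (a + f.[y])) ?inE ?yY ?orbT//.
  by congr (c _); ring.
rewrite mem_cat; apply/orP; right; apply/allpairsP; exists (a, f.[y]).
by split=> //=; apply/allpairsP; exists (f, y).
Qed.

Lemma poly_vdw_derived F f1 :
  (forall f, f \in F -> f.[0] = 0) ->
  (forall Y, poly_vdw (vdw_derived f1 F Y)) -> poly_vdw F.
Proof.
move=> F0 vdwF K Z.
have [A [Y [YZ focus]]] := color_focusing K Z #|K| F0 vdwF.
exists A, Y; split=> // c; have [//|[a [ks [aA ksK col]]]] := focus c.
have /col[y yY cy] : c a \in ks.
  suff -> : ks = [set: K]%SET by rewrite inE.
  by apply/eqP; rewrite eqEcard finset.subsetT cardsT ksK /=.
by exists a, y.
Qed.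

(** Index [j] stands for degree [j + 1], so constants are not counted. *)
Definition lead_coefs F (j : nat) : seq R :=
  undup [seq lead_coef f | f <- F & size f == j.+2].

(** The shift by [h] keeps degree and leading coefficient, and the bounds on [size f1] exclude
    cancellation above degree [j + 1]. *)
Lemma lead_vdw_diff f1 f h j :
  (size f1 <= size f)%N -> (size f1 <= j.+2)%N -> size (vdw_diff f1 f h) = j.+2 ->
  size f = j.+2 /\ lead_coef (vdw_diff f1 f h) = f`_j.+1 - f1`_j.+1.
Proof.
move=> f1f f1j gj.
have sq : size (f \Po ('X + h%:P)) = size f by rewrite size_comp_poly2 ?size_XaddC.
have lq : lead_coef (f \Po ('X + h%:P)) = lead_coef f.
  by rewrite lead_coef_comp ?size_XaddC// lead_coefXaddC expr1n mulr1.
have jf : (j.+2 <= size f)%N.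
  rewrite leqNgt; apply/negP; rewrite ltnS => fj.
  suff: (size (vdw_diff f1 f h) <= j.+1)%N by rewrite gj ltnn.
  apply: leq_trans (size_polyD _ _) _; rewrite geq_max size_polyN.
  rewrite (leq_trans f1f fj) andbT; apply: leq_trans (size_polyD _ _) _.
  by rewrite geq_max size_polyN sq fj (leq_trans (size_polyC_leq1 _)).
have fj : size f = j.+2.
  move: f1f; rewrite leq_eqVlt => /predU1P[f1f|f1f].
    by apply/eqP; rewrite eqn_leq jf -f1f f1j.
  rewrite -gj /vdw_diff -sq size_polyDl ?size_polyDl// ?size_polyN ?sq//.
  - by apply: leq_ltn_trans (size_polyC_leq1 _) _; rewrite (leq_trans _ jf).
  - by apply: leq_ltn_trans (size_polyC_leq1 _) _; rewrite (leq_trans _ jf).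
split=> //; rewrite {1}/lead_coef gj /vdw_diff !coefB coefC subr0 /=.
by move: lq; rewrite /lead_coef sq fj => ->.
Qed.

(** Above the degree of [f1] the subtracted coefficient is zero, so leading coefficients come
    unchanged from [F]. *)
Lemma lead_coefs_derived_gt F f1 Y j :
  (forall f, f \in F -> (size f1 <= size f)%N) -> (size f1 < j.+2)%N ->
  {subset lead_coefs (vdw_derived f1 F Y) j <= lead_coefs F j}.
Proof.
move=> f1min f1j l; rewrite !mem_undup => /mapP[g].
rewrite mem_filter => /andP[/eqP gj /allpairsP[[f h] /= [fF hY gE]]] ->{l}; subst g.
have [fj ->] := lead_vdw_diff (f1min f fF) (ltnW f1j) gj.
rewrite [f1`_ _]nth_default// subr0; apply/mapP; exists f.
  by rewrite mem_filter fj eqxx.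
by rewrite /lead_coef fj.
Qed.

(** In the degree of [f1] leading coefficients are shifted by [- lead_coef f1]; that of [f1] itself
    would become zero and is lost. *)
Lemma size_lead_coefs_derived F f1 Y j :
  (forall f, f \in F -> (size f1 <= size f)%N) -> f1 \in F -> size f1 = j.+2 ->
  (size (lead_coefs (vdw_derived f1 F Y) j) < size (lead_coefs F j))%N.
Proof.
move=> f1min f1F f1j.
have l1 : lead_coef f1 \in lead_coefs F j.
  rewrite mem_undup; apply/mapP; exists f1 => //.
  by rewrite mem_filter f1j eqxx.
rewrite (perm_size (perm_to_rem l1)) /= ltnS.
rewrite -(size_map (fun l => l - lead_coef f1) (rem _ _)).
apply: uniq_leq_size; first exact: undup_uniq.
move=> l; rewrite mem_undup => /mapP[g].
rewrite mem_filter => /andP[/eqP gj /allpairsP[[f h] /= [fF hY gE]]] ->{l}; subst g.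
have f1j' : (size f1 <= j.+2)%N by rewrite f1j.
have [fj lg] := lead_vdw_diff (f1min f fF) f1j' gj.
have {lg} lg : lead_coef (vdw_diff f1 f h) = lead_coef f - lead_coef f1.
  by rewrite lg /lead_coef fj f1j.
rewrite lg; apply/mapP; exists (lead_coef f) => //.
rewrite mem_rem_uniq ?undup_uniq// inE; apply/andP; split.
  rewrite -subr_eq0 -lg lead_coef_eq0; apply/eqP => g0.
  by rewrite g0 size_poly0 in gj.
rewrite mem_undup; apply/mapP; exists f => //.
by rewrite mem_filter fj eqxx.
Qed.

Lemma poly_vdw_filter F : poly_vdw [seq f <- F | f != 0] -> poly_vdw F.
Proof.
move=> vdwF K Z; have [A [Y [YZ good]]] := vdwF K Z; exists A, Y; split=> // c.
have [a [y [aA yY cay]]] := good c; exists a, y; split=> // f fF.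
have [->|f0] := eqVneq f 0; first by rewrite hornerC addr0.
by apply: cay; rewrite mem_filter f0.
Qed.

Theorem polynomial_van_der_waerden F :
  infinite_set [set: R] -> (forall f, f \in F -> f.[0] = 0) -> poly_vdw F.
Proof.
move=> infR.
pose w F j := size (lead_coefs F j).
have [n wF0] : exists n, forall i, (n <= i)%N -> w F i = 0%N.
  exists (\max_(f <- F) size f)%N => i ni; rewrite /w /lead_coefs.
  rewrite (@eq_in_filter _ _ pred0) ?filter_pred0// => f fF /=.
  apply/negbTE; rewrite neq_ltn; apply/orP; left.
  exact: leq_ltn_trans (leq_trans (leq_bigmax_seq _ fF isT) ni) (leqnSn _).
move: n F wF0; apply: (@lexicographic_ind _ w) => F IH F0.
(* Without zero polynomials, a member of least size is nonconstant, since it vanishes at [0]. *)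
apply: poly_vdw_filter; set F' := filter _ F.
have F'0 f : f \in F' -> f.[0] = 0 by rewrite mem_filter => /andP[_ /F0].
have wF' : w F' =1 w F.
  move=> j; rewrite /w /lead_coefs -filter_predI; congr (size (undup (map _ _))).
  by apply: eq_filter => f /=; case: (eqVneq f 0) => [->|]; rewrite ?size_poly0 ?andbT.
have [F'E|[f1 [f1F f1min]]] : F' = [::] \/ exists f1, f1 \in F' /\
    forall f, f \in F' -> (size f1 <= size f)%N.
  case F'E : F' => [|f0 s]; [by left|right; rewrite -F'E].
  have ex_size : exists n, has (fun f : {poly R} => size f == n) F'.
    by exists (size f0); rewrite F'E /= eqxx.
  case: (ex_minnP ex_size) => _ /hasP[f1 f1F /eqP <-] f1min.
  exists f1; split=> // f fF; apply: f1min; apply/hasP.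
  by exists f; rewrite ?eqxx.
  (* With no polynomials left, any [y] outside [Z] will do. *)
  move=> K Z; have [y yZ] : exists y, y \notin Z.
    apply: contrapT => /forallNP yZ; apply: infR.
    by apply/finite_seqP; exists Z; apply/seteqP; split=> // y _; apply/negP/negP; have /negP/negPn := yZ y.
  exists [:: 0], [:: y]; split=> [u|c]; first by rewrite inE => /eqP->.
  by exists 0, y; rewrite F'E; split; rewrite ?mem_head.
apply: (@poly_vdw_derived _ f1) => // Y.
have [f10 f1F'] : f1 != 0 /\ f1 \in F by move: f1F; rewrite mem_filter => /andP.
have [j f1j] : exists j, size f1 = j.+2.
  case sf1 : (size f1) => [|[|j]]; last by exists j.
    by move: f10; rewrite -size_poly_eq0 sf1.
  move/eqP: sf1 f10 (F'0 _ f1F) => /size_poly1P[c c0 ->] _; rewrite hornerC => c00.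
  by rewrite c00 eqxx in c0.
apply: IH => [|g /allpairsP[[f h] /= [fF hY ->]]].
  exists j; first by rewrite -wF' size_lead_coefs_derived.
  move=> i ji; rewrite -wF'; apply: uniq_leq_size; first exact: undup_uniq.
  by apply: lead_coefs_derived_gt => //; rewrite f1j !ltnS.
by rewrite horner_vdw_diff add0r subrr sub0r F'0// oppr0.
Qed.

End PolynomialVanDerWaerden.

(** * Piecewise syndetic sets: partition regularity and polynomial shifts *)

Lemma piecewise_syndetic_seqP (V : zmodType) (A : set V) :
  piecewise_syndetic A <-> exists G : seq V, forall H : seq V,
    exists x, forall h, h \in H -> exists2 t, t \in G & A (t + (h + x)).
Proof.
split=> [[_ [[/finite_seqP[G ->] _] thick]]|[G thick]].
  exists G => H; have HP : Pf [set` 0 :: H].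
    by split; [exact: finite_seq|exists 0 => /=; rewrite mem_head].
  have [x xG] := thick _ HP; exists x => h hH.
  have [|t /= tG At] := xG (h + x); last by exists t.
  by exists h => //=; rewrite inE hH orbT.
exists [set` G]; split.
  split; first exact: finite_seq.
  by have [x /(_ 0 (mem_head _ _))[t tG _]] := thick [:: 0]; exists t.
move=> _ [/finite_seqP[H ->] _]; have [x xG] := thick H.
by exists x => _ [h /xG[t tG At] <-]; exists t.
Qed.

Lemma piecewise_syndeticS (V : zmodType) (A B : set V) :
  A `<=` B -> piecewise_syndetic A -> piecewise_syndetic B.
Proof.
move=> AB /piecewise_syndetic_seqP[G thick]; apply/piecewise_syndetic_seqP.
exists G => H; have [x xG] := thick H; exists x => h /xG[t tG At].
by exists t => //; exact: AB.
Qed.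

Lemma piecewise_syndeticT (V : zmodType) : piecewise_syndetic [set: V].
Proof.
apply/piecewise_syndetic_seqP; exists [:: 0] => H; exists 0 => h _.
by exists 0; rewrite ?mem_head.
Qed.

(** If [B] fails for [G], some finite [K] has in each translate [K + x] a point that no [t] in [G]
    moves into [B]. Such points must be moved into [A], so the sums [t + k] serve as shifts for
    [A]. *)
Lemma piecewise_syndeticU (V : zmodType) (A B : set V) :
  piecewise_syndetic (A `|` B) -> piecewise_syndetic A \/ piecewise_syndetic B.
Proof.
move=> /piecewise_syndetic_seqP[G thick].
have [?|nB] := pselect (piecewise_syndetic B); first by right.
left; apply/piecewise_syndetic_seqP.
have [K nK] : exists K : seq V, forall x, exists2 k, k \in K &
    forall t, t \in G -> ~ B (t + (k + x)).
  apply: contrapT => nK; apply/nB/piecewise_syndetic_seqP; exists G => K.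
  apply: contrapT => nx; apply: nK; exists K => x; apply: contrapT => nk.
  apply: nx; exists x => k kK; apply: contrapT => nt.
  by apply: nk; exists k => // t tG Bt; apply: nt; exists t.
exists [seq t + k | t <- G, k <- K] => H.
have [x xG] := thick [seq h + k | h <- H, k <- K]; exists x => h hH.
have [k kK nBk] := nK (h + x).
have [|t tG ABt] := xG (h + k); first by apply/allpairsP; exists (h, k).
have {}ABt : (A `|` B) (t + (k + (h + x))).
  by congr ((_ `|` _) (_ + _)): ABt; rewrite addrA [k + h]addrC.
exists (t + k); first by apply/allpairsP; exists (t, k).
by case: ABt => [|/nBk//]; rewrite addrA.
Qed.

Lemma piecewise_syndetic_bigcup (V : zmodType) (I : eqType) (s : seq I)
    (A : I -> set V) :
  piecewise_syndetic (\bigcup_(i in [set` s]) A i) ->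
  exists2 i, i \in s & piecewise_syndetic (A i).
Proof.
elim: s => [|i s IH].
  move=> /piecewise_syndetic_seqP[G /(_ [:: 0])[x /(_ 0 (mem_head _ _))]].
  by move=> [t _ [j]].
rewrite [X in piecewise_syndetic X](_ : _ = A i `|` \bigcup_(i in [set` s]) A i).
  move=> /piecewise_syndeticU[Ai|/IH[j js Aj]].
    by exists i; rewrite ?mem_head.
  by exists j; rewrite // inE js orbT.
apply/seteqP; split=> [x [j /=]|x [Aix|[j /= js Ajx]]].
- by rewrite inE => /orP[/eqP->|js]; [left|right; exists j].
- by exists i; rewrite //= mem_head.
- by exists j; rewrite //= inE js orbT.
Qed.

(** Colour [u] by the first [t] in [G] moving [h + u + x] into [A]. A monochromatic configuration
    shares one [t], so [t + a] moves [h + x] into the wanted set for some [y] in [Y]; partition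
    regularity then fixes [y]. *)
Lemma piecewise_syndetic_poly_shift (R : idomainType) (A : set R)
    (F : seq {poly R}) (Z : seq R) :
  poly_vdw F -> piecewise_syndetic A ->
  exists2 y, y \notin Z &
    piecewise_syndetic [set x | A x /\ forall f, f \in F -> A (x + f.[y])].
Proof.
move=> vdwF /piecewise_syndetic_seqP[G thick].
(* The extra colour is the value [size G] of [find] when no [t] works. *)
have [W [Y [YZ vdw]]] := vdwF 'I_(size G).+1 Z.
suff /piecewise_syndetic_bigcup[y yY] : piecewise_syndetic
    (\bigcup_(y in [set` Y]) [set x | A x /\ forall f, f \in F -> A (x + f.[y])]).
  by exists y => //; exact: YZ.
apply/piecewise_syndetic_seqP; exists [seq t + a | t <- G, a <- W] => H.
have [x xG] := thick [seq h + w | h <- H,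
  w <- W ++ [seq a + b | a <- W, b <- [seq f.[y] | f <- F, y <- Y]]].
exists x => h hH.
pose p u := find (fun t => `[< A (t + (h + u + x)) >]) G.
have [a [y [aW yY cy]]] := vdw (fun u => inord (p u)).
have pA u : (p u < size G)%N -> A (nth 0 G (p u) + (h + u + x)).
  by rewrite -has_find => /(nth_find 0)/asboolP.
have ltp u : u \in W ++ [seq a + b | a <- W, b <- [seq f.[y] | f <- F, y <- Y]] ->
    (p u < size G)%N.
  move=> uW; have [|t tG At] := xG (h + u); first by apply/allpairsP; exists (h, u).
  by rewrite -has_find; apply/hasP; exists t => //; apply/asboolP.
have pa : (p a < size G)%N by apply: ltp; rewrite mem_cat aW.
exists (nth 0 G (p a) + a).
  by apply/allpairsP; exists (nth 0 G (p a), a); rewrite mem_nth.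
exists y => //; split=> [|f fF].
  by have := pA _ pa; congr (A _); ring.
have paf : (p (a + f.[y])%R < size G)%N.
  apply: ltp; rewrite mem_cat; apply/orP; right; apply/allpairsP.
  by exists (a, f.[y]); split=> //=; apply/allpairsP; exists (f, y).
have paE : p (a + f.[y]) = p a.
  by have := congr1 (@nat_of_ord _) (cy f fF); rewrite !inordK// ltnS ltnW.
by have := pA _ paf; rewrite paE; congr (A _); ring.
Qed.

(** * Finite index and dilation by a nonzero element *)

Lemma finite_index_reps (V : zmodType) (H : set V) : H 0 -> finite_index H ->
  exists T : seq V, forall a, exists t h, [/\ t \in T, H h & t = a + h].
Proof.
(* [xget 0] picks one representative from each coset. *)
move=> H0 finH; have /finite_seqP[T TE] := finite_image (xget 0) finH.
exists T => a; have [h Hh hE] : coset H a (xget 0 (coset H a)).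
  by apply: (@xgetPex _ 0); exists a; exists 0; rewrite ?addr0.
exists (xget 0 (coset H a)), h; split=> //.
suff: [set` T] (xget 0 (coset H a)) by [].
by rewrite -TE; exists (coset H a) => //; exists a.
Qed.

Section Dilation.
Variables (R : idomainType) (hR : large_ideal_domain R) (y : R).
Hypothesis y0 : y != 0.

Lemma dilation_reps :
  exists T : seq R, forall a, exists t k, t \in T /\ t = a + y * k.
Proof.
have yR : ideal [set y * k | k in [set: R]].
  split=> [|_ _ [a _ <-] [b _ <-]|a _ [b _ <-]].
  - by exists 0; rewrite ?mulr0.
  - by exists (a + b); rewrite ?mulrDr.
  - by exists (a * b); rewrite // mulrCA.
have yR_neq0 : [set y * k | k in [set: R]] <> [set 0].
  move=> yRE; have : [set y * k | k in [set: R]] y by exists 1; rewrite ?mulr1.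
  by rewrite yRE => /eqP; apply/negP.
have [T TP] := finite_index_reps (let: And3 yR0 _ _ := yR in yR0)
  (hR.2 _ yR yR_neq0).
by exists T => a; have [t [_ [tT [k _ <-] tE]]] := TP a; exists t, k.
Qed.

(** An [h] need not be a multiple of [y], but differs from some [y * k h] by an element of the
    finite list [T], which the shifts absorb. *)
Lemma piecewise_syndetic_dilation (A : set R) :
  piecewise_syndetic A -> piecewise_syndetic [set y * a | a in A].
Proof.
move=> /piecewise_syndetic_seqP[G thick]; apply/piecewise_syndetic_seqP.
have [T TP] := dilation_reps.
have /choice[k kP] : forall h, exists k, - h + y * k \in T.
  by move=> h; have [t [k [tT tE]]] := TP (- h); exists k; rewrite -tE.
exists [seq u + y * t | u <- T, t <- G] => H.
have [x xG] := thick [seq k h | h <- H]; exists (y * x) => h hH.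
have [|t tG At] := xG (k h); first exact: map_f.
exists (- h + y * k h + y * t).
  by apply/allpairsP; exists (- h + y * k h, t); split=> //=; exact: kP.
by exists (t + (k h + x)) => //; ring.
Qed.

(** Replacing [x] by its representative [u] modulo [yR] makes [t + u] a multiple of [y]; the
    finitely many quotients are the new shifts. *)
Lemma piecewise_syndetic_undilation (A : set R) :
  piecewise_syndetic [set y * a | a in A] -> piecewise_syndetic A.
Proof.
move=> /piecewise_syndetic_seqP[G thick]; apply/piecewise_syndetic_seqP.
have [T TP] := dilation_reps.
(* [q] divides multiples of [y] by [y] and is [0] elsewhere. *)
have [q qP] : exists q : R -> R, forall v, q (y * v) = v.
  have /choice[q qP] : forall u, exists v, forall w, u = y * w -> v = w.
    move=> u; have [[v ->]|nv] := pselect (exists v, u = y * v).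
      by exists v => w /(mulfI y0).
    by exists 0 => w uE; case: nv; exists w.
  by exists q => v; apply: qP.
exists [seq q (t + u) | t <- G, u <- T] => H.
have [x xG] := thick [seq y * h | h <- H].
have [u [k [uT uE]]] := TP x.
exists (- k) => h hH; have [|t tG [a Aa aE]] := xG (y * h); first exact: map_f.
exists (q (t + u)); first by apply/allpairsP; exists (t, u).
suff -> : t + u = y * (a - h + k) by rewrite qP; move: Aa; congr A; ring.
by rewrite uE; rewrite [y * (_ + _)]mulrDr mulrBr aE; ring.
Qed.

End Dilation.

(** * Chains of colour classes and the repetition of a colour *)

Section ColorChain.
Variables (R : idomainType) (hR : large_ideal_domain R) (r : nat).
Variables (F : set {poly R}) (C : 'I_r -> set R).
Hypotheses (hF : F `<=` @xRx R) (finF : finite_set F).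
Hypothesis (hC : [set: R] = \bigcup_(i in [set: 'I_r]) C i).

Definition mono_base (i : 'I_r) (y : R) : set R :=
  [set x | [set x * y] `|` [set x + f.[y] | f in F] `<=` C i].

(* [B] plays the role of the last set of a chain [B_0, B_1, ...]; an entry
   [(p, i)] of [L] records an earlier [B_m], contained in the colour class
   [C i], such that [B] is contained in [p * B_m]. *)
Definition color_chain (B : set R) (L : seq (R * 'I_r)) : Prop :=
  [/\ piecewise_syndetic B, uniq [seq u.2 | u <- L]
    & forall u, u \in L -> u.1 != 0 /\ B `<=` [set u.1 * x | x in C u.2]].

(** Multiplication by each [u.1] is injective, so only finitely many [y] are excluded. *)
Lemma avoid_multiples (L : seq (R * 'I_r)) (Z : seq R) :
  (forall u, u \in L -> u.1 != 0) ->
  exists Z' : seq R, forall y, y \notin Z' ->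
    y != 0 /\ forall u, u \in L -> y * u.1 \notin Z.
Proof.
elim: L => [|u L IH] L0; first by exists [:: 0] => y; rewrite inE.
have [v vL|Z' Z'P] := IH; first by apply: L0; rewrite inE vL orbT.
have u0 : u.1 != 0 by apply: L0; rewrite mem_head.
have [Zu ZuE] : exists Zu : seq R, [set y | y * u.1 \in Z] = [set` Zu].
  apply/finite_seqP; apply: (@finite_preimage _ _ [set` Z] (fun y => y * u.1)).
    by move=> a b _ _; apply: mulIf.
  exact: finite_seq.
exists (Zu ++ Z') => y; rewrite mem_cat negb_or => /andP[yZu /Z'P[y0 yL]].
split=> // v; rewrite inE => /predU1P[->|/yL//].
apply: contra yZu => yZ.
by suff: [set` Zu] y by []; rewrite -ZuE.
Qed.

Lemma color_chain_step (B : set R) (L : seq (R * 'I_r)) (Z : seq R) :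
  color_chain B L ->
  (exists i y, y \notin Z /\ piecewise_syndetic (mono_base i y)) \/
  exists B' L', size L' = (size L).+1 /\ color_chain B' L'.
Proof.
move=> [psB uniqL BL].
have [Fs FE] := (finite_seqP _).1 finF.
pose G := [seq u.1 *: (f \Po (u.1 *: 'X)) | u <- L, f <- Fs].
have GE u f y : (u *: (f \Po (u *: 'X))).[y] = u * f.[y * u] :> R.
  by rewrite hornerZ horner_comp hornerZ hornerX [u * y]mulrC.
have vdwG : poly_vdw G.
  apply: polynomial_van_der_waerden; first exact: hR.1.
  move=> _ /allpairsP[[u f] /= [uL fF ->]].
  rewrite GE mul0r horner_coef0 (_ : f`_0 = 0) ?mulr0//.
  by apply: hF; rewrite FE.
have [Z' Z'P] := avoid_multiples Z (fun u uL => (BL u uL).1).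
have [y /Z'P[y0 yL] psD] := piecewise_syndetic_poly_shift Z' vdwG psB.
set D := (X in piecewise_syndetic X) in psD.
have [i _ psDi] : exists2 i, i \in enum 'I_r &
    piecewise_syndetic (D `&` [set x | C i (y * x)]).
  apply: piecewise_syndetic_bigcup; apply: piecewise_syndeticS psD => x Dx.
  have [i _ Ci] : (\bigcup_(i in [set: 'I_r]) C i) (y * x) by rewrite -hC.
  by exists i; rewrite //= mem_enum.
have [/mapP[[p j] uL /= ij]|iL] := boolP (i \in [seq u.2 | u <- L]).
  subst j; left; exists i, (y * p); split; first exact: yL uL.
  have [/= p0 BC] := BL _ uL.
  (* Each [z] in the set is [p * x] with [y * z = x * (y * p)], and [z + p * f.[y * p]] in [B] gives
     [x + f.[y * p]] in [C i] after cancelling [p]. *)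
  apply: (piecewise_syndetic_undilation hR p0).
  apply: piecewise_syndeticS psDi => z [[Bz Gz] /= Ciz].
  have [x Cx zE] := BC _ Bz; exists x => // w [->|[f Ff <-]].
    by move: Ciz; rewrite -zE; congr (C i _); ring.
  have [|x' Cx' x'E] := BC (z + p * f.[y * p]).
    rewrite -GE; apply: Gz; apply/allpairsP; exists ((p, i), f).
    by split=> //=; move: Ff; rewrite FE.
  suff <- : x' = x + f.[y * p] by [].
  by apply: (mulfI p0); rewrite mulrDr x'E -zE.
(* For a new colour, the entry [(1, i)] records the new set itself; the older multipliers gain a
   factor [y]. *)
right; exists [set y * x | x in D `&` [set x | C i (y * x)]].
exists ((1, i) :: [seq (y * u.1, u.2) | u <- L]); split.
  by rewrite /= size_map.
split; first exact: (piecewise_syndetic_dilation hR y0).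
  by rewrite /= -map_comp iL.
move=> u; rewrite inE => /predU1P[->|/mapP[v vL ->]] /=.
  split; first exact: oner_neq0.
  by move=> _ [x [_ Cx] <-]; exists (y * x); rewrite ?mul1r.
have [v0 BC] := BL _ vL; split; first by rewrite mulf_neq0.
by move=> _ [x [[/BC[z Cz <-] _] _] <-]; exists z; rewrite ?mulrA.
Qed.

(** Otherwise chains would grow until they carry [r + 1] distinct colours out of [r]. *)
Lemma mono_base_avoiding (Z : seq R) :
  exists i y, y \notin Z /\ piecewise_syndetic (mono_base i y).
Proof.
apply: contrapT => nZ.
have chain n : exists B L, size L = n /\ color_chain B L.
  elim: n => [|n [B [L [<- /(color_chain_step Z)[/nZ//|//]]]]].
  by exists setT, [::]; do 2?split; first exact: piecewise_syndeticT.
have [B [L [sL [_ /card_uniqP uL _]]]] := chain r.+1.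
by have := max_card (mem [seq u.2 | u <- L]); rewrite uL size_map sL card_ord ltnn.
Qed.

End ColorChain.

Theorem theorem1p7 (R : idomainType) (hR : large_ideal_domain R)
    (r : nat) (hr : (0 < r)%N)
    (F : set {poly R}) (hF : F `<=` @xRx R) (finF : finite_set F)
    (C : 'I_r -> set R) (hC : [set: R] = \bigcup_(i in [set: 'I_r]) C i) :
  exists i : 'I_r,
    infinite_set
      [set y : R |
        piecewise_syndetic
          [set x : R | [set x * y] `|` [set x + f.[y] | f in F] `<=` C i]].
Proof.
(* If every colour had finitely many good [y], all of them would form a finite list [Z], yet a good
   [y] exists outside it. *)
apply: contrapT => fin_y.
have /finite_seqP[Z ZE] : finite_set
    (\bigcup_(i in [set: 'I_r]) [set y | piecewise_syndetic (mono_base F C i y)]).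
  apply: bigcup_finite; first exact: finite_finset.
  by move=> i _; apply: contrapT => ?; apply: fin_y; exists i.
have [i [y [yZ psy]]] := mono_base_avoiding hR hF finF hC Z.
move/negP: yZ; apply.
by suff: [set` Z] y by []; rewrite -ZE; exists i.
Qed.
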